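(* Let $X$ be a Lowen fuzzy topological space and let $\mathcal{C}_X=\{1-\mu:\mu\in\tau_X\}$ be its fuzzy closed-set lattice. For $\lambda\in\tau_X$ and $\Phi\in\Sigma_X$, the following are equivalent: (i) $\lambda\triangleleft\Phi$; (ii) for every $F\in\mathcal{C}_X$, $$F\le K\vee\underline{1-\Phi(1-F)},\qquad\text{where } K=1-\lambda.$$ Moreover, $X$ satisfies stratified Scott–core approximation (SKA) if and only if $$F=\bigwedge_{\substack{\Phi\in\Sigma_X,\ \lambda\in\tau_X\\ \lambda\triangleleft\Phi}}\Bigl((1-\lambda)\vee\underline{1-\Phi(1-F)}\Bigr)\qquad\text{for all }F\in\mathcal{C}_X.$$
   Context: Let $\mathbb{I}=[0,1]$ with its usual order; $\underline{a}$ denotes the constant map with value $a\in\mathbb{I}$; joins, meets, complements $1-\mu$ and the order $\le$ of $\mathbb{I}$-valued maps are pointwise. A (stratified) Lowen fuzzy topology on a set $X$ is a subset $\tau_X\subseteq\mathbb{I}^X$ containing all constant maps and closed under arbitrary pointwise joins and finite pointwise meets; $(X,\tau_X)$ is a Lowen fuzzy topological space and members of $\tau_X$ are called fuzzy open. Finite products carry the least Lowen topology containing all composites of fuzzy opens of the factors with the projections. $\mathbb{S}=(\mathbb{I},\delta_{\mathbb{S}})$, where $\delta_{\mathbb{S}}$ is the least Lowen topology on $\mathbb{I}$ containing $\mathrm{id}_{\mathbb{I}}$. Regard $\tau_X$ as a complete lattice in the pointwise order; directed sets are nonempty. A map $\Phi:\tau_X\to\mathbb{I}$ is Scott-continuous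 if it is monotone and $\Phi(\bigvee D)=\bigvee_{\mu\in D}\Phi(\mu)$ for every directed $D\subseteq\tau_X$. It satisfies finite-tier compatibility (FTC) if for every $n\ge1$ and $\beta_1,\dots,\beta_n\in\tau_X$ the map $\mathbb{I}^n\to\mathbb{I}$, $(r_1,\dots,r_n)\mapsto\Phi\bigl(\bigvee_{i=1}^n(\underline{r_i}\wedge\beta_i)\bigr)$ is fuzzy open in the product $\mathbb{S}^n$. $\Sigma_X$ is the set of all Scott-continuous $\Phi:\tau_X\to\mathbb{I}$ satisfying FTC. For $\lambda\in\tau_X$ and $\Phi\in\Sigma_X$, $\lambda\triangleleft\Phi$ means $\underline{\Phi(\nu)}\wedge\lambda\le\nu$ for all $\nu\in\tau_X$. $X$ satisfies SKA if $\mu=\bigvee_{\Phi\in\Sigma_X,\,\lambda\in\tau_X,\,\lambda\triangleleft\Phi}(\underline{\Phi(\mu)}\wedge\lambda)$ for every $\mu\in\tau_X$. *)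

(* Defs.v *)
From mathcomp Require Import all_boot all_order all_algebra.
From mathcomp Require Import interval_inference.
From mathcomp Require Import all_classical all_reals.
Set Implicit Arguments.
Unset Strict Implicit.
Unset Printing Implicit Defensive.
Import Order.TTheory GRing.Theory Num.Theory.

Local Open Scope classical_set_scope.
Local Open Scope order_scope.

Section UnitInterval.
Variable R : realType.
Implicit Types (a b : {i01 R}) (A : set {i01 R}).

(* Joins and meets are taken inside [0, 1]: the empty join is 0 and the empty
   meet is 1. *)
Definition isup A : {i01 R} := supremum 0%:i01%R A.
Definition iinf A : {i01 R} := infimum 1%:i01%R A.
Definition icompl a : {i01 R} := (1 - a%:num)%:i01%R.

Lemma i01_ge0 a : 0%:i01%R <= a.
Proof. by rewrite -num_le /= ge0. Qed.

Lemma i01_le1 a : a <= 1%:i01%R.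
Proof. by rewrite -num_le /= le1. Qed.

Lemma num_icompl a : (icompl a)%:num%R = (1 - a%:num)%R.
Proof. by []. Qed.

Lemma icomplK : involutive icompl.
Proof. by move=> a; apply/val_inj; rewrite /= subKr. Qed.

Lemma le_icompl a b : (icompl a <= icompl b) = (b <= a).
Proof. by rewrite -!num_le /= lerD2l lerN2. Qed.

Lemma isup_supremums A : supremums A (isup A).
Proof.
rewrite /isup /supremum; case: ifPn => [/eqP->|/set0P[a Aa]].
  by split=> [b []|b _]; exact: i01_ge0.
set B := [set x%:num%R | x in A] : set R.
have hB : has_sup B.
  split; first by exists a%:num%R, a.
  by exists 1%R => _ [x _ <-]; exact: le1.
have s0 : (0 <= sup B)%R.
  by apply: (le_trans (ge0 a)); apply: ub_le_sup; [case: hB|exists a].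
have s1 : (sup B <= 1)%R.
  by apply: ge_sup; [case: hB|move=> _ [x _ <-]; exact: le1].
case: xgetP => // /(_ (Itv01 s0 s1)) []; split=> [b Ab|b ubb].
  by rewrite -num_le /=; apply: ub_le_sup; [case: hB|exists b].
rewrite -num_le /=; apply: ge_sup; first by case: hB.
by move=> _ [x Ax <-]; rewrite num_le; exact: ubb.
Qed.

Lemma iinf_infimums A : infimums A (iinf A).
Proof.
rewrite /iinf /infimum; case: ifPn => [/eqP->|_].
  by split=> [b []|b _]; exact: i01_le1.
have [ub lub] := isup_supremums (icompl @` A).
case: xgetP => // /(_ (icompl (isup (icompl @` A)))) []; split=> [b Ab|b lbb].
  by rewrite -[b]icomplK le_icompl; apply: ub; exists b.
rewrite -[b]icomplK le_icompl; apply: lub => _ [x Ax <-].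
by rewrite le_icompl; exact: lbb.
Qed.

End UnitInterval.

Section FuzzySets.
Variables (R : realType) (T : Type).

(* The order and the binary joins and meets of maps T -> {i01 R} are the
   pointwise ones of boolp. *)
Definition fjoin (A : set (T -> {i01 R})) : T -> {i01 R} :=
  fun x => isup [set mu x | mu in A].

Definition fmeet (A : set (T -> {i01 R})) : T -> {i01 R} :=
  fun x => iinf [set mu x | mu in A].

Definition fcompl (mu : T -> {i01 R}) : T -> {i01 R} :=
  fun x => icompl (mu x).

Lemma fcomplK : involutive fcompl.
Proof. by move=> mu; apply/funext => x; exact: icomplK. Qed.

(* The empty meet is the constant map 1, so binary meets suffice. *)
Definition lowen_topology (tau : set (T -> {i01 R})) : Prop :=
  [/\ forall a : {i01 R}, tau (cst a),
      forall A : set (T -> {i01 R}), A `<=` tau -> tau (fjoin A)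
    & forall mu nu, tau mu -> tau nu -> tau (mu `&` nu)].

Lemma smallest_lowen_topology (G : set (T -> {i01 R})) :
  lowen_topology (smallest lowen_topology G).
Proof.
split=> [a tau [[c _ _] _]|A sA tau [lt Gt]|mu nu hmu hnu tau [lt Gt]].
- exact: c.
- by case: (lt) => _ j _; apply: j => mu Amu; apply: (sA _ Amu).
- by case: (lt) => _ _ m; apply: m; [apply: hmu|apply: hnu].
Qed.

End FuzzySets.

Record lowenSpace (R : realType) := LowenSpace {
  points :> Type;
  fuzzy_open : set (points -> {i01 R});
  fuzzy_openP : lowen_topology fuzzy_open
}.

Definition generated_lowenSpace (R : realType) (T : Type)
    (G : set (T -> {i01 R})) : lowenSpace R :=
  LowenSpace (smallest_lowen_topology G).

Definition sierpinski (R : realType) : lowenSpace R :=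
  generated_lowenSpace [set @id {i01 R}].

Definition lowen_prod (R : realType) (n : nat) (Y : 'I_n -> lowenSpace R) :
    lowenSpace R :=
  generated_lowenSpace
    [set f | exists (i : 'I_n) (mu : Y i -> {i01 R}),
        fuzzy_open mu /\ f = (fun y : (forall j, Y j) => mu (y i))].

Section ScottCores.
Variables (R : realType) (X : lowenSpace R).

Definition opens : Type := set_type (@fuzzy_open R X).

Definition fuzzy_closed : set (X -> {i01 R}) :=
  [set fcompl mu | mu in @fuzzy_open R X].

Definition closeds : Type := set_type fuzzy_closed.

Definition mk_open (mu : X -> {i01 R}) (hmu : fuzzy_open mu) : opens :=
  exist (fun f => f \in @fuzzy_open R X) mu (mem_set hmu).

Lemma ojoin_subproof (D : set opens) : @fuzzy_open R X (fjoin (val @` D)).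
Proof.
by case: (fuzzy_openP X) => _ j _; apply: j => _ [mu _ <-]; exact: set_valP.
Qed.

Definition ojoin (D : set opens) : opens := mk_open (ojoin_subproof D).

Lemma ocap_subproof (a : {i01 R}) (mu : opens) :
  @fuzzy_open R X (cst a `&` val mu).
Proof.
by case: (fuzzy_openP X) => c _ m; apply: m; [exact: c|exact: set_valP].
Qed.

Definition ocap (a : {i01 R}) (mu : opens) : opens :=
  mk_open (ocap_subproof a mu).

Lemma ocompl_subproof (F : closeds) : @fuzzy_open R X (fcompl (val F)).
Proof. by case: (set_valP F) => mu hmu <-; rewrite fcomplK. Qed.

Definition ocompl (F : closeds) : opens := mk_open (ocompl_subproof F).

Definition directed (D : set opens) : Prop :=
  D !=set0 /\
  forall mu nu, D mu -> D nu ->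
    exists2 xi, D xi & val mu <= val xi /\ val nu <= val xi.

Definition scott_continuous (Phi : opens -> {i01 R}) : Prop :=
  (forall mu nu : opens, val mu <= val nu -> Phi mu <= Phi nu) /\
  (forall D : set opens, directed D -> Phi (ojoin D) = isup (Phi @` D)).

Definition finite_tier_compatible (Phi : opens -> {i01 R}) : Prop :=
  forall (n : nat) (beta : 'I_n -> opens), (1 <= n)%N ->
    @fuzzy_open R (lowen_prod (fun _ : 'I_n => sierpinski R))
      (fun r : 'I_n -> {i01 R} =>
         Phi (ojoin [set ocap (r i) (beta i) | i in [set: 'I_n]])).

Definition Sigma : set (opens -> {i01 R}) :=
  [set Phi | scott_continuous Phi /\ finite_tier_compatible Phi].

Definition scott_core (lambda : opens) (Phi : opens -> {i01 R}) : Prop :=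
  forall nu : opens, cst (Phi nu) `&` val lambda <= val nu.

Definition SKA : Prop :=
  forall mu : opens,
    val mu = fjoin [set f : X -> {i01 R} |
      exists (Phi : opens -> {i01 R}) (lambda : opens),
        [/\ Sigma Phi, scott_core lambda Phi
          & f = cst (Phi mu) `&` val lambda]].

End ScottCores.

(* Main.v *)
Require Import Defs.
From mathcomp Require Import all_boot all_order all_algebra.
From mathcomp Require Import interval_inference.
From mathcomp Require Import all_classical all_reals.
Import Order.TTheory.

(** Pointwise complementation is an order-reversing involution of the fuzzy
    sets.  It therefore exchanges arbitrary joins with arbitrary meets
    ([fcompl_fjoin]) and turns [cst a `&` mu] into
    [fcompl mu `|` cst (icompl a)] ([fcompl_cst_meet]); moreover it
    restricts to a bijection between closed and open sets
    ([forall_ocompl]).  In each of the two equivalences, the two sides are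
    images of each other under this duality.  With [nu := ocompl F], the inequality
    [cst (Phi nu) `&` lambda <= nu] that defines a core is, after
    complementation, the one required of [F]; and the join that expresses
    approximation of [nu] becomes the meet that expresses approximation of
    [F], the index set of pairs [(Phi, lambda)] being the same on both
    sides. *)

Local Open Scope classical_set_scope.
Local Open Scope order_scope.

Section ComplementDuality.
Variables (R : realType) (T : Type).
Implicit Types (a b : {i01 R}) (mu nu : T -> {i01 R}).

Lemma icompl_meet a b : icompl (a `&` b) = icompl a `|` icompl b.
Proof.
by case: (leP a b) => [ab|/ltW ba]; apply/esym;
  [apply/join_idPl|apply/join_idPr]; rewrite le_icompl.
Qed.

(** An order-reversing involution carries a supremum to an infimum, and
    infima are unique.  This covers the empty set, where it reads
    [icompl 0 = 1]. *)
Lemma icompl_isup (A : set {i01 R}) : icompl (isup A) = iinf (@icompl R @` A).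
Proof.
have [ubA leastA] := isup_supremums A.
apply: is_subset1_infimums (iinf_infimums _); split=> [_ [a Aa <-]|b lbb].
  by rewrite le_icompl; exact: ubA.
rewrite -[b]icomplK le_icompl; apply: leastA => a Aa.
by rewrite -le_icompl icomplK; apply: lbb; exists a.
Qed.

Lemma le_fcompl mu nu : (fcompl mu <= fcompl nu) = (nu <= mu).
Proof. by apply/lefP/lefP => le x; move: (le x); rewrite le_icompl. Qed.

Lemma fcompl_cst_meet a mu :
  fcompl (cst a `&` mu) = fcompl mu `|` cst (icompl a).
Proof.
by apply/funext => x; rewrite /fcompl meetfE icompl_meet joinC joinfE.
Qed.

Lemma fcompl_fjoin (A : set (T -> {i01 R})) :
  fcompl (fjoin A) = fmeet (@fcompl R T @` A).
Proof.
apply/funext => x; rewrite /fmeet image_comp.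
by rewrite /fcompl /fjoin icompl_isup image_comp.
Qed.

End ComplementDuality.

(** Every open set is the complement of a closed one, so a property may be
    quantified over either lattice. *)
Lemma forall_ocompl (R : realType) (X : lowenSpace R) (P : opens X -> Prop) :
  (forall nu, P nu) <-> (forall F : closeds X, P (ocompl F)).
Proof.
split=> [Pop F|Pcl nu]; first exact: Pop.
have clnu : fcompl (val nu) \in @fuzzy_closed R X.
  by apply/mem_set; exists (val nu); first exact: set_valP.
suff <- : ocompl (Sub (fcompl (val nu)) clnu : closeds X) = nu by exact: Pcl.
by apply/val_inj; exact: fcomplK.
Qed.

Theorem proposition5p4 (R : realType) (X : lowenSpace R) :
  (forall (lambda : opens X) (Phi : opens X -> {i01 R}), Sigma Phi ->
     (scott_core lambda Phi <->
      forall F : closeds X,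
        val F <= fcompl (val lambda) `|` cst (icompl (Phi (ocompl F)))))
  /\
  (SKA X <->
   forall F : closeds X,
     val F = fmeet [set f : X -> {i01 R} |
       exists (Phi : opens X -> {i01 R}) (lambda : opens X),
         [/\ Sigma Phi, scott_core lambda Phi
           & f = fcompl (val lambda) `|` cst (icompl (Phi (ocompl F)))]]).
Proof.
split=> [lambda Phi _|].
  have dual F : (cst (Phi (ocompl F)) `&` val lambda <= val (ocompl F)) =
      (val F <= fcompl (val lambda) `|` cst (icompl (Phi (ocompl F)))).
    by rewrite -fcompl_cst_meet -le_fcompl fcomplK.
  rewrite /scott_core forall_ocompl.
  by split=> core F; move: (core F); rewrite dual.
have dual (F : closeds X) :
    fcompl (fjoin [set f : X -> {i01 R} |
      exists (Phi : opens X -> {i01 R}) (lambda : opens X),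
        [/\ Sigma Phi, scott_core lambda Phi
          & f = cst (Phi (ocompl F)) `&` val lambda]]) =
    fmeet [set f : X -> {i01 R} |
      exists (Phi : opens X -> {i01 R}) (lambda : opens X),
        [/\ Sigma Phi, scott_core lambda Phi
          & f = fcompl (val lambda) `|` cst (icompl (Phi (ocompl F)))]].
  rewrite fcompl_fjoin; congr fmeet; apply/seteqP; split.
    move=> _ [_ [Phi [lambda [SPhi core ->]]] <-].
    by exists Phi, lambda; rewrite fcompl_cst_meet.
  move=> _ [Phi [lambda [SPhi core ->]]].
  exists (cst (Phi (ocompl F)) `&` val lambda); last exact: fcompl_cst_meet.
  by exists Phi, lambda.
rewrite /SKA forall_ocompl; split=> approx F.
  by rewrite -dual -approx /= fcomplK.
by apply: (inv_inj (@fcomplK R X)); rewrite dual -approx; exact: fcomplK.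
Qed.
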